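(* Let $\widetilde V_h^k$ and $\widetilde V_h^{k+1}$ be broken spaces, $D_k:\widetilde V_h^k\to\widetilde V_h^{k+1}$ an elementwise differential operator (a matrix acting on coefficients), and $J_k$, $J_{k+1}$ matrices of smoothness functionals (rows not necessarily independent) on $\widetilde V_h^k$ and $\widetilde V_h^{k+1}$. The following are equivalent: (i) $D_k(\ker J_k)\subset\ker J_{k+1}$; (ii) $\operatorname{range}\bigl((J_{k+1}D_k)^T\bigr)\subset\operatorname{range}(J_k^T)$; (iii) there is a matrix $B_k$ with $J_{k+1}D_k=B_kJ_k$. If the smoothness functionals and the differential operator are assembled edge by edge and (iii) holds on every edge patch (i.e. for each edge $e$ there is a matrix $B_{k,e}$ with $J_{k+1,e}D_k=B_{k,e}J_{k,e}$), then (iii) holds globally with $B_k$ block diagonal by edges.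
   Context: A broken space $\widetilde V_h^k$ is a finite-dimensional real coefficient space $\mathbb R^{N_k}$ that is the direct sum over the triangles $T$ of a triangulation of local (polynomial) coefficient spaces; $D_k$ is elementwise, i.e. block diagonal with respect to triangles. A matrix of smoothness functionals $J_k$ is a real matrix with $N_k$ columns whose rows are linear functionals on the coefficients. Assembled edge by edge means that $J_k$ and $J_{k+1}$ are the stacks over the edges $e$ of blocks $J_{k,e}$ and $J_{k+1,e}$, where the functionals of block $e$ involve only the coefficients on the triangles incident to $e$ (the edge patch of $e$). *)

(* Defs.v *)
From HB Require Import structures.
From mathcomp Require Import all_boot all_order all_algebra.
From mathcomp Require Import classical_sets reals.

Set Implicit Arguments.
Unset Strict Implicit.
Unset Printing Implicit Defensive.

Import Order.TTheory GRing.Theory Num.Theory.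
Local Open Scope classical_set_scope.
Local Open Scope ring_scope.

(* Only the incidences between edges and triangles matter below, so a
   triangulation is recorded combinatorially, by the vertex sets of its
   triangles. *)
Record triangulation (V : finType) := Triangulation {
  triangles : {set {set V}};
  card_triangle : forall t, t \in triangles -> #|t| = 3%N;
  edge_in_at_most_two : forall e : {set V}, #|e| = 2%N ->
    (#|[set t in triangles | e \subset t]%SET| <= 2)%N
}.

Section Mesh.
Variables (V : finType) (Th : triangulation V).

Definition edges : {set {set V}} :=
  [set e : {set V} | (#|e| == 2%N) && [exists t in triangles Th, e \subset t]]%SET.

(* Triangles and edges are numbered so as to index the blocks of MathComp's
   block matrices; the number of a simplex is its rank in [enum]. *)
Definition triangle_idx := 'I_#|triangles Th|.
Definition edge_idx := 'I_#|edges|.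

Definition patch (e : edge_idx) : {set triangle_idx} :=
  [set t : triangle_idx | enum_val e \subset enum_val t]%SET.

(* The dimension N of the broken space whose local space on the triangle t has
   dimension n t; its elements are the column vectors 'cV[R]_(broken_dim n). *)
Definition broken_dim (n : triangle_idx -> nat) : nat := (\sum_t n t)%N.

Definition supported_on_patch (R : realType) (n : triangle_idx -> nat) (r : nat)
    (e : edge_idx) (Je : 'M[R]_(r, broken_dim n)) : Prop :=
  forall t : triangle_idx, t \notin patch e -> submxrow Je t = 0.

End Mesh.

(* The blocks may be rectangular, which rules out [\mxdiag]. *)
Definition block_diagonal (R : realType) (b : nat) (p q : 'I_b -> nat)
    (A : 'M[R]_(\sum_i p i, \sum_i q i)) : Prop :=
  forall i j : 'I_b, i != j -> submxblock A i j = 0.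

(* Matrices act on column vectors, whereas [kermx] is the kernel of the action
   on row vectors. *)
Definition mxker (R : realType) (m n : nat) (A : 'M[R]_(m, n)) : set 'cV[R]_n :=
  [set v | A *m v = 0].

Definition mxrange (R : realType) (m n : nat) (A : 'M[R]_(m, n)) : set 'cV[R]_m :=
  range (fun x : 'cV[R]_n => A *m x).

(* Main.v *)
Require Import Defs.
From HB Require Import structures.
From mathcomp Require Import all_boot all_order all_algebra.
From mathcomp Require Import classical_sets reals.

Set Implicit Arguments.
Unset Strict Implicit.
Unset Printing Implicit Defensive.

Import Order.TTheory GRing.Theory Num.Theory.
Local Open Scope classical_set_scope.
Local Open Scope ring_scope.

(** Each of the three conditions says that the row space of [J1 *m D] lies in that of [J0], written
    [(J1 *m D <= J0)%MS]. For (iii) this is [submxP]; for (ii) it is the same fact transposed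
    ([mxrange_tr_subP]); for (i) it is duality, since the functionals vanishing on [mxker J0] are
    exactly the combinations of the rows of [J0] ([mxker_subP]). For the edgewise part, the local
    factors are placed on the diagonal of one matrix, which acts on a stack block by block
    ([mul_block_diag_mxcol]). *)

Lemma mxker_subP (R : realType) (m p n : nat)
    (A : 'M[R]_(m, n)) (C : 'M[R]_(p, n)) :
  mxker A `<=` mxker C <-> (C <= A)%MS.
Proof.
split=> [kerAC | /submxP[B ->] v Av0].
  rewrite submxE; apply/eqP/row_matrixP=> i; apply/rowP=> j.
  (* By [submxE] the goal is [C *m cokermx A = 0], so it suffices to test [C] on the columns of
     [cokermx A], which [A] kills. *)
  have /kerAC : mxker A (col j (cokermx A)).
    by rewrite /mxker /= colE mulmxA mulmx_coker mul0mx.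
  by rewrite /mxker /= colE mulmxA -colE => /colP/(_ i); rewrite !mxE.
by rewrite /mxker /= -mulmxA Av0 mulmx0.
Qed.

Lemma mxrange_tr_subP (R : realType) (m p n : nat)
    (A : 'M[R]_(m, n)) (C : 'M[R]_(p, n)) :
  mxrange C^T `<=` mxrange A^T <-> (C <= A)%MS.
Proof.
split=> [ranCA | /submxP[B ->] _ [x _ <-]].
  apply/row_subP=> i.
  (* Row [i] of [C] is, transposed, the image under [C^T] of a basis vector; a preimage [y] under
     [A^T] gives its coefficients on the rows of [A]. *)
  have [|y _ Ay] := ranCA (C^T *m delta_mx i 0); first by exists (delta_mx i 0).
  apply/submxP; exists y^T.
  by rewrite rowE -[LHS]trmxK trmx_mul trmx_delta -Ay trmx_mul trmxK.
by exists (B^T *m x); rewrite // trmx_mul mulmxA.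
Qed.

(* [conform_mx] only casts [B i] along [q i = q j], which is not definitional. *)
Definition block_diag_mx (R : realType) (b : nat) (p q : 'I_b -> nat)
    (B : forall i, 'M[R]_(p i, q i)) : 'M[R]_(\sum_i p i, \sum_i q i) :=
  \mxblock_(i, j) if i == j then conform_mx 0 (B i) else 0.

Lemma block_diag_mxP (R : realType) (b : nat) (p q : 'I_b -> nat)
    (B : forall i, 'M[R]_(p i, q i)) : block_diagonal (block_diag_mx B).
Proof. by move=> i j /negPf ij; rewrite mxblockK ij. Qed.

Lemma mul_block_diag_mxcol (R : realType) (b n : nat) (p q : 'I_b -> nat)
    (B : forall i, 'M[R]_(p i, q i)) (C : forall i, 'M[R]_(q i, n)) :
  block_diag_mx B *m (\mxcol_i C i) = \mxcol_i (B i *m C i).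
Proof.
rewrite mul_mxblock_mxrow; apply/eq_mxcol=> i.
(* Only the term [j = i] survives, and there the cast is the identity. *)
rewrite (bigD1 i) //= eqxx conform_mx_id big1 ?addr0 // => j.
by rewrite eq_sym => /negPf ->; rewrite mul0mx.
Qed.

Theorem theorem5p1 (R : realType) (V : finType) (Th : triangulation V)
    (n0 n1 : triangle_idx Th -> nat)
    (D : 'M[R]_(broken_dim n1, broken_dim n0))
    (D_elementwise : block_diagonal D) :
  (forall (m0 m1 : nat)
      (J0 : 'M[R]_(m0, broken_dim n0)) (J1 : 'M[R]_(m1, broken_dim n1)),
    let cond_i := [set D *m v | v in mxker J0] `<=` mxker J1 in
    let cond_ii := mxrange (J1 *m D)^T `<=` mxrange J0^T in
    let cond_iii := exists B : 'M[R]_(m1, m0), J1 *m D = B *m J0 in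
    (cond_i <-> cond_ii) /\ (cond_ii <-> cond_iii)) /\
  (forall (r0 r1 : edge_idx Th -> nat)
      (J0 : forall e : edge_idx Th, 'M[R]_(r0 e, broken_dim n0))
      (J1 : forall e : edge_idx Th, 'M[R]_(r1 e, broken_dim n1)),
    (forall e, supported_on_patch e (J0 e)) ->
    (forall e, supported_on_patch e (J1 e)) ->
    (forall e, exists Be : 'M[R]_(r1 e, r0 e), J1 e *m D = Be *m J0 e) ->
    exists B : 'M[R]_(\sum_e r1 e, \sum_e r0 e),
      block_diagonal B /\ (\mxcol_e J1 e) *m D = B *m (\mxcol_e J0 e)).
Proof.
split=> [m0 m1 J0 J1 cond_i cond_ii cond_iii | r0 r1 J0 J1 _ _ /fin_all_exists[B JB]].
  have iP : cond_i <-> (J1 *m D <= J0)%MS.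
    (* [D *m v] lies in [mxker J1] exactly when [v] lies in [mxker (J1 *m D)]. *)
    rewrite -mxker_subP; split=> [DJ v J0v | DJ _ [v J0v <-]].
      by rewrite /mxker /= -mulmxA; apply: DJ; exists v.
    by rewrite /mxker /= mulmxA; apply: DJ.
  have iiP : cond_ii <-> (J1 *m D <= J0)%MS by apply: mxrange_tr_subP.
  have iiiP : cond_iii <-> (J1 *m D <= J0)%MS by split=> /submxP.
  by split; [rewrite iP iiP | rewrite iiP iiiP].
(* [B] is a simultaneous choice of the local factors, made by [fin_all_exists] over the finitely
   many edges. *)
exists (block_diag_mx B); split; first exact: block_diag_mxP.
by rewrite mul_block_diag_mxcol mxcol_mul; apply/eq_mxcol.
Qed.
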